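(* Let $\mathsf{C}$ be a partializable Markov category. (i) Idempotents in $\mathsf{Partial}(\mathsf{C})$ are idempotents on their domains in $\mathsf{C}$: a morphism of $\mathsf{Partial}(\mathsf{C})$ represented by $X\xleftarrow{i}A\xrightarrow{f}X$ is idempotent if and only if it can be represented by a span $X\xleftarrow{i}A\xrightarrow{i\circ e}X$ for an idempotent $e\colon A\to A$ in $\mathsf{C}$. (ii) If all idempotents in $\mathsf{C}$ split, then all idempotents in $\mathsf{Partial}(\mathsf{C})$ split. (iii) An idempotent of $\mathsf{Partial}(\mathsf{C})$ represented by $(A,i,i\circ e)$, with $e$ an idempotent of $\mathsf{C}$, is static (respectively strong, respectively balanced) if and only if $e$ is static (respectively strong, respectively balanced).
   Context: A CD category is a symmetric monoidal category $(\mathsf{C},\otimes,I)$ in which every object $X$ carries a commutative comonoid structure $\mathrm{copy}_X\colon X\to X\otimes X$, $\mathrm{del}_X\colon X\to I$, compatible with tensor products ($\mathrm{copy}_{X\otimes Y}$ is $\mathrm{copy}_X\otimes\mathrm{copy}_Y$ followed by swapping the two middle factors, and $\mathrm{del}_{X\otimes Y}=\mathrm{del}_X\otimes\mathrm{del}_Y$) and with $\mathrm{copy}_I=\mathrm{del}_I=\mathrm{id}_I$; coherence isomorphisms are suppressed. A morphism $f\colon X\to Y$ is total if $\mathrm{del}_Y\circ f=\mathrm{del}_X$, copyable if $\mathrm{copy}_Y\circ f=(f\otimes f)\circ\mathrm{copy}_X$, and deterministic if it is both. A Markov category is a CD category in which every morphism is total. A Markov category is positive if for all $u\colon X\to Y$,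 $v\colon Y\to Z$ with $v\circ u$ deterministic, $(u\otimes (v\circ u))\circ\mathrm{copy}_X=(\mathrm{id}_Y\otimes v)\circ\mathrm{copy}_Y\circ u$. A Markov category $\mathsf{C}$ is partializable if: (i) it is positive; (ii) pullbacks of deterministic monomorphisms along arbitrary morphisms exist and are themselves deterministic (monomorphisms); (iii) if $i\colon D\to X$ is a deterministic monomorphism then $i\otimes\mathrm{id}_A$ is a monomorphism for every object $A$. For $\mathsf{C}$ partializable, the CD category $\mathsf{Partial}(\mathsf{C})$ has the objects of $\mathsf{C}$; its morphisms $X\to Y$ are equivalence classes of spans $X\xleftarrow{i}D\xrightarrow{f}Y$ (also written $(D,i,f)$) in $\mathsf{C}$ with $i$ a deterministic monomorphism, where $(D,i,f)\sim(D',i',f')$ iff there is an isomorphism $t\colon D\to D'$ with $i'\circ t=i$, $f'\circ t=f$. The composite of $(A,i,f)\colon X\to Y$ followed by $(B,j,g)\colon Y\to Z$ is $(C,i\circ u,g\circ v)$, where $A\xleftarrow{u}C\xrightarrow{v}B$ is the pullback of $f$ and $j$. The inclusion $\mathsf{C}\hookrightarrow\mathsf{Partial}(\mathsf{C})$ sends $f\colon X\to Y$ to $(X,\mathrm{id}_X,f)$. The tensor product is componentwise, $(A,i,f)\otimes(B,j,g)=(A\otimes B,i\otimes j,f\otimes g)$, and the copy and delete maps (and coherence isomorphisms) are the images of those of $\mathsf{C}$ under the inclusion. An idempotent $e\colon X\to X$ splits if $e=s\circ r$ for some $r\colon X\to E$, $s\colon E\to X$ with $r\circ s=\mathrm{id}_E$.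 In a CD category an idempotent $e\colon X\to X$ is: balanced if $(e\otimes\mathrm{id}_X)\circ\mathrm{copy}_X\circ e=(e\otimes e)\circ\mathrm{copy}_X\circ e$; static if $(e\otimes\mathrm{id}_X)\circ\mathrm{copy}_X\circ e=\mathrm{copy}_X\circ e$; strong if $(e\otimes\mathrm{id}_X)\circ\mathrm{copy}_X\circ e=(e\otimes e)\circ\mathrm{copy}_X$. *)

(* Defs.v *)
From HB Require Import structures.
From mathcomp Require Import all_boot.
From mathcomp Require Import generic_quotient boolp.

Set Implicit Arguments.
Unset Strict Implicit.
Unset Printing Implicit Defensive.

Declare Scope cd_scope.
Delimit Scope cd_scope with cd.
Local Open Scope quotient_scope.
Local Open Scope cd_scope.

Reserved Notation "g ∘ f" (at level 40, left associativity).
Reserved Notation "X ⊗ Y" (at level 38, left associativity).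
Reserved Notation "f ⊠ g" (at level 38, left associativity).

Record category := Category {
  ob :> Type;
  hom : ob -> ob -> Type;
  idm : forall X, hom X X;
  comp : forall X Y Z, hom Y Z -> hom X Y -> hom X Z;
  comp1m : forall X Y (f : hom X Y), comp (idm Y) f = f;
  compm1 : forall X Y (f : hom X Y), comp f (idm X) = f;
  compA : forall W X Y Z (h : hom Y Z) (g : hom X Y) (f : hom W X),
    comp h (comp g f) = comp (comp h g) f }.

Arguments idm {c} X.
Arguments comp {c X Y Z} g f.
Notation "g ∘ f" := (comp g f) : cd_scope.

Section CategoryNotions.
Variable C : category.
Implicit Types X Y Z A B D T : C.

Definition mono X Y (m : hom X Y) : Prop :=
  forall T (g h : hom T X), m ∘ g = m ∘ h -> g = h.

Definition is_iso X Y (t : hom X Y) : Prop :=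
  exists t' : hom Y X, t' ∘ t = idm X /\ t ∘ t' = idm Y.

Definition idempotent X (e : hom X X) : Prop := e ∘ e = e.

Definition splits X (e : hom X X) : Prop :=
  exists (E : C) (r : hom X E) (s : hom E X), e = s ∘ r /\ r ∘ s = idm E.

Definition is_pullback A B Y (f : hom A Y) (j : hom B Y)
    D (u : hom D A) (v : hom D B) : Prop :=
  f ∘ u = j ∘ v /\
  forall T (h : hom T A) (k : hom T B), f ∘ h = j ∘ k ->
    exists! w : hom T D, u ∘ w = h /\ v ∘ w = k.

End CategoryNotions.

(* Coherence isomorphisms are kept explicit, so that non-strict examples are   *)
(* covered.  The axioms are those of Mac Lane's original presentation, hence   *)
(* include the (derivable) unit conditions smc_unit and smc_braid_unit.        *)
Record smcategory := SMCategory {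
  smc_cat :> category;
  tens : smc_cat -> smc_cat -> smc_cat;
  tensm : forall X X' Y Y' : smc_cat,
    hom X X' -> hom Y Y' -> hom (tens X Y) (tens X' Y');
  unit_ob : smc_cat;
  assoc : forall X Y Z : smc_cat,
    hom (tens (tens X Y) Z) (tens X (tens Y Z));
  assocV : forall X Y Z : smc_cat,
    hom (tens X (tens Y Z)) (tens (tens X Y) Z);
  lunit : forall X : smc_cat, hom (tens unit_ob X) X;
  lunitV : forall X : smc_cat, hom X (tens unit_ob X);
  runit : forall X : smc_cat, hom (tens X unit_ob) X;
  runitV : forall X : smc_cat, hom X (tens X unit_ob);
  braid : forall X Y : smc_cat, hom (tens X Y) (tens Y X);
  tensm1 : forall X Y : smc_cat, tensm (idm X) (idm Y) = idm (tens X Y);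
  tensmM : forall (X Y Z X' Y' Z' : smc_cat) (g : hom Y Z) (f : hom X Y)
      (g' : hom Y' Z') (f' : hom X' Y'),
    tensm (g ∘ f) (g' ∘ f') = tensm g g' ∘ tensm f f';
  assocK : forall X Y Z, assocV X Y Z ∘ assoc X Y Z = idm _;
  assocVK : forall X Y Z, assoc X Y Z ∘ assocV X Y Z = idm _;
  lunitK : forall X, lunitV X ∘ lunit X = idm _;
  lunitVK : forall X, lunit X ∘ lunitV X = idm _;
  runitK : forall X, runitV X ∘ runit X = idm _;
  runitVK : forall X, runit X ∘ runitV X = idm _;
  braidK : forall X Y, braid Y X ∘ braid X Y = idm _;
  assoc_nat : forall (X X' Y Y' Z Z' : smc_cat)
      (f : hom X X') (g : hom Y Y') (h : hom Z Z'),
    assoc X' Y' Z' ∘ tensm (tensm f g) h = tensm f (tensm g h) ∘ assoc X Y Z;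
  lunit_nat : forall (X X' : smc_cat) (f : hom X X'),
    lunit X' ∘ tensm (idm unit_ob) f = f ∘ lunit X;
  runit_nat : forall (X X' : smc_cat) (f : hom X X'),
    runit X' ∘ tensm f (idm unit_ob) = f ∘ runit X;
  braid_nat : forall (X X' Y Y' : smc_cat) (f : hom X X') (g : hom Y Y'),
    braid X' Y' ∘ tensm f g = tensm g f ∘ braid X Y;
  smc_triangle : forall X Y,
    tensm (idm X) (lunit Y) ∘ assoc X unit_ob Y = tensm (runit X) (idm Y);
  smc_pentagon : forall W X Y Z,
    assoc W X (tens Y Z) ∘ assoc (tens W X) Y Z =
    tensm (idm W) (assoc X Y Z) ∘ assoc W (tens X Y) Z
      ∘ tensm (assoc W X Y) (idm Z);
  smc_hexagon : forall X Y Z,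
    assoc Y Z X ∘ braid X (tens Y Z) ∘ assoc X Y Z =
    tensm (idm Y) (braid X Z) ∘ assoc Y X Z ∘ tensm (braid X Y) (idm Z);
  smc_unit : lunit unit_ob = runit unit_ob;
  smc_braid_unit : forall X, lunit X ∘ braid X unit_ob = runit X }.

Arguments unit_ob {s}.
Notation "X ⊗ Y" := (tens X Y) : cd_scope.
Notation "f ⊠ g" := (tensm f g) : cd_scope.

Definition swap_mid (C : smcategory) (W X Y Z : C) :
    hom ((W ⊗ X) ⊗ (Y ⊗ Z)) ((W ⊗ Y) ⊗ (X ⊗ Z)) :=
  assocV W Y (X ⊗ Z)
    ∘ (idm W ⊠ (assoc Y X Z ∘ (braid X Y ⊠ idm Z) ∘ assocV X Y Z))
    ∘ assoc W X (Y ⊗ Z).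

Record cd_category := CDCategory {
  cd_smc :> smcategory;
  copy : forall X : cd_smc, hom X (X ⊗ X);
  del : forall X : cd_smc, hom X unit_ob;
  copyA : forall X : cd_smc,
    assoc X X X ∘ (copy X ⊠ idm X) ∘ copy X = (idm X ⊠ copy X) ∘ copy X;
  copy_dell : forall X : cd_smc,
    lunit X ∘ (del X ⊠ idm X) ∘ copy X = idm X;
  copyC : forall X : cd_smc, braid X X ∘ copy X = copy X;
  copy_tens : forall X Y : cd_smc,
    copy (X ⊗ Y) = swap_mid X X Y Y ∘ (copy X ⊠ copy Y);
  del_tens : forall X Y : cd_smc,
    del (X ⊗ Y) = lunit unit_ob ∘ (del X ⊠ del Y);
  copy_unit : copy (unit_ob : cd_smc) = lunitV unit_ob;
  del_unit : del (unit_ob : cd_smc) = idm unit_ob }.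

Arguments copy {c} X.
Arguments del {c} X.

Section CDNotions.
Variable C : cd_category.
Implicit Types X Y Z : C.

Definition total X Y (f : hom X Y) : Prop := del Y ∘ f = del X.

Definition copyable X Y (f : hom X Y) : Prop :=
  copy Y ∘ f = (f ⊠ f) ∘ copy X.

Definition deterministic X Y (f : hom X Y) : Prop := total f /\ copyable f.

Definition det_mono X Y (i : hom X Y) : Prop := deterministic i /\ mono i.

Definition balanced X (e : hom X X) : Prop :=
  idempotent e /\ (e ⊠ idm X) ∘ copy X ∘ e = (e ⊠ e) ∘ copy X ∘ e.

Definition static X (e : hom X X) : Prop :=
  idempotent e /\ (e ⊠ idm X) ∘ copy X ∘ e = copy X ∘ e.

Definition strong X (e : hom X X) : Prop :=
  idempotent e /\ (e ⊠ idm X) ∘ copy X ∘ e = (e ⊠ e) ∘ copy X.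

End CDNotions.

Record markov_category := MarkovCategory {
  markov_cd :> cd_category;
  markov_total : forall (X Y : markov_cd) (f : hom X Y), total f }.

Definition positive (C : markov_category) : Prop :=
  forall (X Y Z : C) (u : hom X Y) (v : hom Y Z), deterministic (v ∘ u) ->
    (u ⊠ (v ∘ u)) ∘ copy X = (idm Y ⊠ v) ∘ copy Y ∘ u.

Record partializable (C : markov_category) : Prop := Partializable {
  partializable_pos : positive C;
  partializable_pb_ex : forall (A B Y : C) (f : hom A Y) (j : hom B Y),
    det_mono j ->
    exists (D : C) (u : hom D A) (v : hom D B), is_pullback f j u v;
  partializable_pb_det : forall (A B Y : C) (f : hom A Y) (j : hom B Y),
    det_mono j ->
    forall (D : C) (u : hom D A) (v : hom D B),
      is_pullback f j u v -> det_mono u;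
  partializable_tens : forall (D X : C) (i : hom D X), det_mono i ->
    forall A : C, mono (i ⊠ idm A) }.

Section CategoryTheory.
Variable C : category.
Implicit Types X Y Z A B D T : C.

Lemma mono1 X : mono (idm X).
Proof. by move=> T g h; rewrite !comp1m. Qed.

Lemma monoM X Y Z (g : hom Y Z) (f : hom X Y) : mono g -> mono f -> mono (g ∘ f).
Proof. by move=> mg mf T a b; rewrite -!compA => /mg/mf. Qed.

Lemma iso1 X : is_iso (idm X).
Proof. by exists (idm X); rewrite comp1m. Qed.

Lemma iso_mono X Y (f : hom X Y) : is_iso f -> mono f.
Proof.
move=> [f' [f'f _]] T g h /(congr1 (comp f')).
by rewrite !compA f'f !comp1m.
Qed.

Lemma pb_mono A B Y (f : hom A Y) (j : hom B Y) D (u : hom D A) (v : hom D B) :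
  is_pullback f j u v -> mono j -> mono u.
Proof.
move=> [e U] mj T g h E.
have Ev : v ∘ g = v ∘ h by apply: mj; rewrite !compA -e -!compA E.
have /U[w [_ uw]] : f ∘ (u ∘ h) = j ∘ (v ∘ h) by rewrite !compA e.
by rewrite -(uw g) ?(uw h) // E Ev.
Qed.

(* For a mono leg, uniqueness of the mediating morphism is automatic, and only *)
(* its u-component has to be checked.                                          *)
Lemma pb_intro A B Y (f : hom A Y) (j : hom B Y) D (u : hom D A) (v : hom D B) :
  mono j -> mono u -> f ∘ u = j ∘ v ->
  (forall T (h : hom T A) (k : hom T B), f ∘ h = j ∘ k ->
     exists w : hom T D, u ∘ w = h) ->
  is_pullback f j u v.
Proof.
move=> mj mu e U; split=> // T h k E.
have [w uw] := U T h k E; exists w; split.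
  by split=> //; apply: mj; rewrite compA -e -compA uw.
by move=> w' [uw' _]; apply: mu; rewrite uw uw'.
Qed.

Lemma pb_factor A B Y (f : hom A Y) (j : hom B Y) D (u : hom D A) (v : hom D B)
    T (h : hom T A) (k : hom T B) :
  is_pullback f j u v -> f ∘ h = j ∘ k -> exists w, u ∘ w = h /\ v ∘ w = k.
Proof. by move=> [_ U] /U[w [wP _]]; exists w. Qed.

End CategoryTheory.

Section SMTheory.
Variable C : smcategory.
Implicit Types X Y Z A B D T : C.

Lemma tensml X X' Y Y' (f : hom X X') (g : hom Y Y') :
  f ⊠ g = (f ⊠ idm Y') ∘ (idm X ⊠ g).
Proof. by rewrite -tensmM comp1m compm1. Qed.

Lemma assocV_nat X X' Y Y' Z Z' (f : hom X X') (g : hom Y Y') (h : hom Z Z') :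
  assocV X' Y' Z' ∘ (f ⊠ (g ⊠ h)) = ((f ⊠ g) ⊠ h) ∘ assocV X Y Z.
Proof.
rewrite -[LHS]compm1 -(assocVK X Y Z) !compA -(compA (assocV _ _ _)).
by rewrite -assoc_nat compA assocK comp1m.
Qed.

Lemma swap_mid_nat W X Y Z W' X' Y' Z'
    (f : hom W W') (g : hom X X') (h : hom Y Y') (k : hom Z Z') :
  swap_mid W' X' Y' Z' ∘ ((f ⊠ g) ⊠ (h ⊠ k)) =
  ((f ⊠ h) ⊠ (g ⊠ k)) ∘ swap_mid W X Y Z.
Proof.
rewrite /swap_mid -!compA assoc_nat !compA -assocV_nat -!compA; congr (_ ∘ _).
rewrite !compA -!tensmM comp1m compm1; congr (_ ⊠ _ ∘ _).
rewrite -!compA assocV_nat !compA -assoc_nat -!compA; congr (_ ∘ _).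
by rewrite !compA -!tensmM braid_nat comp1m compm1.
Qed.

Lemma braid_unit : braid unit_ob unit_ob = idm ((unit_ob : C) ⊗ unit_ob).
Proof.
rewrite -[LHS]comp1m -(lunitK unit_ob) -compA smc_braid_unit -smc_unit.
by rewrite lunitK.
Qed.

Lemma swap_mid_unit X Y : swap_mid X (unit_ob : C) unit_ob Y = idm _.
Proof.
by rewrite /swap_mid braid_unit tensm1 compm1 assocVK tensm1 compm1 assocK.
Qed.

End SMTheory.

Section CDTheory.
Variable C : cd_category.
Implicit Types X Y Z A B D T : C.

Lemma det1 X : deterministic (idm X).
Proof. by split; rewrite /total /copyable ?tensm1 ?comp1m compm1. Qed.

Lemma det_mono1 X : det_mono (idm X).
Proof. by split; [exact: det1 | exact: mono1]. Qed.

Lemma detM X Y Z (g : hom Y Z) (f : hom X Y) :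
  deterministic g -> deterministic f -> deterministic (g ∘ f).
Proof.
move=> [tg cg] [tf cf]; split; rewrite /total /copyable.
  by rewrite compA tg tf.
by rewrite compA cg -compA cf compA -tensmM.
Qed.

Lemma det_monoM X Y Z (g : hom Y Z) (f : hom X Y) :
  det_mono g -> det_mono f -> det_mono (g ∘ f).
Proof. by move=> [dg mg] [df mf]; split; [exact: detM | exact: monoM]. Qed.

Lemma det_tens X X' Y Y' (f : hom X X') (g : hom Y Y') :
  deterministic f -> deterministic g -> deterministic (f ⊠ g).
Proof.
move=> [tf cf] [tg cg]; split; rewrite /total /copyable.
  by rewrite !del_tens -compA -tensmM tf tg.
rewrite !copy_tens -compA -tensmM cf cg tensmM compA swap_mid_nat.
by rewrite -compA.
Qed.

Lemma copy_delr X : runit X ∘ (idm X ⊠ del X) ∘ copy X = idm X.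
Proof.
rewrite -copyC -smc_braid_unit !compA -(compA _ (idm X ⊠ _)) -braid_nat.
by rewrite -(compA (lunit X)) (compA _ _ (_ ⊠ _)) braidK comp1m copy_dell.
Qed.

Definition projl X Y : hom (X ⊗ Y) X := runit X ∘ (idm X ⊠ del Y).
Definition projr X Y : hom (X ⊗ Y) Y := lunit Y ∘ (del X ⊠ idm Y).

Lemma copy_proj X Y : (projl X Y ⊠ projr X Y) ∘ copy (X ⊗ Y) = idm _.
Proof.
rewrite copy_tens /projl /projr tensmM -(compA (runit X ⊠ _)).
rewrite (compA (_ ⊠ _) (swap_mid _ _ _ _)) -swap_mid_nat swap_mid_unit comp1m.
by rewrite compA -!tensmM copy_delr copy_dell tensm1.
Qed.

End CDTheory.

Section MarkovTheory.
Variable C : markov_category.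
Hypothesis hC : partializable C.
Implicit Types X Y Z A B D T W : C.

Lemma mono_idtens A D X (i : hom D X) : det_mono i -> mono (idm A ⊠ i).
Proof.
move=> /(partializable_tens hC)/(_ A) mi T g h.
move=> /(congr1 (comp (braid _ _))); rewrite !compA braid_nat -!compA => /mi.
by move=> /(congr1 (comp (braid _ _))); rewrite !compA braidK !comp1m.
Qed.

Lemma det_mono_tens X X' Y Y' (i : hom X X') (j : hom Y Y') :
  det_mono i -> det_mono j -> det_mono (i ⊠ j).
Proof.
move=> di dj; split; first by apply: det_tens; [case: di | case: dj].
rewrite tensml; apply: monoM; first exact: (partializable_tens hC).
exact: mono_idtens.
Qed.

Lemma projl_nat X X' Y Y' (f : hom X X') (g : hom Y Y') :
  projl X' Y' ∘ (f ⊠ g) = f ∘ projl X Y.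
Proof.
rewrite /projl -compA -tensmM (markov_total g) comp1m -{1}(compm1 f).
by rewrite -{1}(comp1m (del Y)) tensmM compA runit_nat -compA.
Qed.

Lemma projr_braid X Y : projl Y X ∘ braid X Y = projr X Y.
Proof.
rewrite /projl /projr -compA -braid_nat compA; congr (_ ∘ _).
by rewrite -smc_braid_unit -compA braidK compm1.
Qed.

Lemma projr_nat X X' Y Y' (f : hom X X') (g : hom Y Y') :
  projr X' Y' ∘ (f ⊠ g) = g ∘ projr X Y.
Proof.
by rewrite -!projr_braid -compA braid_nat (compA (projl _ _)) projl_nat -compA.
Qed.

(* The crucial step: u ⊠ idm W is the pullback of u along the projection. *)
Lemma factor_tens A D W T (u : hom D A) (h : hom T (A ⊗ W)) (w : hom T D) :
  det_mono u -> projl A W ∘ h = u ∘ w -> exists h', (u ⊠ idm W) ∘ h' = h.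
Proof.
move=> du E; have [P [p [q pb]]] := partializable_pb_ex hC (projl A W) du.
have [dp _] := partializable_pb_det hC du pb.
have [x [<- _]] := pb_factor pb E.
have -> : p = (u ⊠ idm W) ∘ ((q ⊠ (projr A W ∘ p)) ∘ copy P).
  case: pb => pq _; rewrite compA -tensmM -pq comp1m.
  by rewrite tensmM -compA; case: dp => _ <-; rewrite compA copy_proj comp1m.
by eexists; rewrite -compA.
Qed.

Lemma factor_tens2 A D A' D' T (u : hom D A) (u' : hom D' A')
    (h : hom T (A ⊗ A')) (w : hom T D) (w' : hom T D') :
  det_mono u -> det_mono u' -> projl A A' ∘ h = u ∘ w ->
  projr A A' ∘ h = u' ∘ w' -> exists h', (u ⊠ u') ∘ h' = h.
Proof.
move=> du du' E E'; have [h1 Eh1] := factor_tens du E.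
have [h2 Eh2] : exists h2, (u' ⊠ idm D) ∘ h2 = braid D A' ∘ h1.
  apply: (@factor_tens _ _ _ _ _ _ w') => //.
  by rewrite compA projr_braid -E' -Eh1 (compA (projr _ _)) projr_nat comp1m.
exists (braid D' D ∘ h2).
rewrite tensml -compA (compA (idm D ⊠ u')) -braid_nat -(compA (braid _ _)) Eh2.
by rewrite (compA (braid _ _)) braidK comp1m.
Qed.

Lemma pb_tens A B Y D A' B' Y' D' (f : hom A Y) (j : hom B Y) (u : hom D A)
    (v : hom D B) (f' : hom A' Y') (j' : hom B' Y') (u' : hom D' A')
    (v' : hom D' B') : det_mono j -> det_mono j' ->
  is_pullback f j u v -> is_pullback f' j' u' v' ->
  is_pullback (f ⊠ f') (j ⊠ j') (u ⊠ u') (v ⊠ v').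
Proof.
move=> dj dj' pb pb'; have du := partializable_pb_det hC dj pb.
have du' := partializable_pb_det hC dj' pb'.
apply: pb_intro; [by case: (det_mono_tens dj dj') |
  by case: (det_mono_tens du du') | |].
  by rewrite -!tensmM; case: pb => -> _; case: pb' => -> _.
move=> T h k E.
have /(pb_factor pb)[w [/esym Ew _]] : f ∘ (projl _ _ ∘ h) = j ∘ (projl _ _ ∘ k).
  by rewrite (compA f) (compA j) -(projl_nat f f') -(projl_nat j j') -!compA E.
have /(pb_factor pb')[w' [/esym Ew' _]] :
    f' ∘ (projr _ _ ∘ h) = j' ∘ (projr _ _ ∘ k).
  by rewrite (compA f') (compA j') -(projr_nat f f') -(projr_nat j j') -!compA E.
exact: factor_tens2 Ew Ew'.
Qed.

Lemma pb_paste A B Y D (f : hom A Y) (j : hom B Y) (u : hom D A) (v : hom D B)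
    A' D' (g : hom A' A) (u' : hom D' A') (v' : hom D' D) :
  mono j -> is_pullback f j u v -> is_pullback g u u' v' ->
  is_pullback (f ∘ g) j u' (v ∘ v').
Proof.
move=> mj pb pb'; have mu := pb_mono pb mj.
apply: pb_intro => //; first exact: pb_mono pb' mu.
  by case: pb pb' => e _ [e' _]; rewrite -compA e' !compA e.
move=> T h k; rewrite -compA => /(pb_factor pb)[w [/esym Ew _]].
by have [w' [Ew' _]] := pb_factor pb' Ew; exists w'.
Qed.

Lemma pb_paste_mono A B Y D (f : hom A Y) (j : hom B Y) (u : hom D A)
    (v : hom D B) B' D' (k : hom B' B) (u' : hom D' D) (v' : hom D' B') :
  mono j -> mono k -> is_pullback f j u v -> is_pullback v k u' v' ->
  is_pullback f (j ∘ k) (u ∘ u') v'.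
Proof.
move=> mj mk pb pb'; have mu := pb_mono pb mj; have mu' := pb_mono pb' mk.
apply: pb_intro; [exact: monoM | exact: monoM | |].
  by case: pb pb' => e _ [e' _]; rewrite compA e -!compA e'.
move=> T h l; rewrite -compA => /(pb_factor pb)[w [Ew Ew']].
have [w' [Ew2 _]] := pb_factor pb' Ew'.
by exists w'; rewrite -compA Ew2.
Qed.

Lemma pb_iso A B Y D (f : hom A Y) (j : hom B Y) (u : hom D A) (v : hom D B) :
  is_iso f -> is_iso v -> mono j -> mono u -> f ∘ u = j ∘ v ->
  is_pullback f j u v.
Proof.
move=> fi [v' [_ vv']] mj mu e; apply: pb_intro => // T h k E.
exists (v' ∘ k); apply: (iso_mono fi).
by rewrite compA e -compA (compA v) vv' comp1m.
Qed.

End MarkovTheory.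

Record span (C : cd_category) (X Y : C) := Span {
  sdom : C;
  sleg : hom sdom X;
  sleg_det_mono : det_mono sleg;
  smap : hom sdom Y }.

Arguments Span {C X Y sdom} sleg sleg_det_mono smap.

Section Spans.
Variable C : cd_category.
Implicit Types X Y Z : C.

HB.instance Definition _ X Y := gen_eqMixin (span X Y).
HB.instance Definition _ X Y := gen_choiceMixin (span X Y).

Definition span_equiv X Y (s s' : span X Y) : Prop :=
  exists t : hom (sdom s) (sdom s'),
    [/\ is_iso t, sleg s' ∘ t = sleg s & smap s' ∘ t = smap s].

Definition span_le X Y (s s' : span X Y) : Prop :=
  exists t : hom (sdom s) (sdom s'),
    sleg s' ∘ t = sleg s /\ smap s' ∘ t = smap s.

Lemma span_equivW X Y (s s' : span X Y) :
  span_equiv s s' <-> span_le s s' /\ span_le s' s.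
Proof.
split=> [[t [[t' [e1 e2]] e3 e4]]|[[t [e1 e2]] [t' [e3 e4]]]].
  split; [by exists t | exists t'].
  by rewrite -e3 -e4 -!compA e2 !compm1.
exists t; split=> //; exists t'; split.
  by apply: (sleg_det_mono s).2; rewrite compA e3 compm1.
by apply: (sleg_det_mono s').2; rewrite compA e1 compm1.
Qed.

Lemma span_le_refl X Y (s : span X Y) : span_le s s.
Proof. by exists (idm _); rewrite !compm1. Qed.

Lemma span_le_trans X Y (s2 s1 s3 : span X Y) :
  span_le s1 s2 -> span_le s2 s3 -> span_le s1 s3.
Proof.
move=> [t [e1 e2]] [t' [e3 e4]]; exists (t' ∘ t).
by rewrite -e1 -e2 -e3 -e4 !compA.
Qed.

Definition span_eqb X Y (s s' : span X Y) : bool := `[< span_equiv s s' >].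

Lemma span_eqb_refl X Y : reflexive (@span_eqb X Y).
Proof. by move=> s; apply/asboolP/span_equivW; split; exact: span_le_refl. Qed.

Lemma span_eqb_sym X Y : symmetric (@span_eqb X Y).
Proof.
by move=> s s'; apply/asboolP/asboolP => /span_equivW[? ?]; apply/span_equivW.
Qed.

Lemma span_eqb_trans X Y : transitive (@span_eqb X Y).
Proof.
move=> s2 s1 s3 /asboolP/span_equivW[a b] /asboolP/span_equivW[c d].
by apply/asboolP/span_equivW; split; apply: (span_le_trans (s2 := s2)).
Qed.

Canonical span_equiv_rel X Y :=
  EquivRel (@span_eqb X Y) (@span_eqb_refl X Y) (@span_eqb_sym X Y)
    (@span_eqb_trans X Y).

Definition phom X Y := {eq_quot (span_equiv_rel X Y)}.

Definition span_class X Y (s : span X Y) : phom X Y := \pi_(phom X Y) s.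

Lemma span_classP X Y (s s' : span X Y) :
  span_class s = span_class s' <-> span_equiv s s'.
Proof. by split=> [/eqmodP/asboolP|/asboolP ?] //; apply/eqmodP. Qed.

Lemma span_classE X Y (p : phom X Y) : p = span_class (repr p).
Proof. by rewrite /span_class reprK. Qed.

Lemma span_class_ext X Y D (i i' : hom D X) (hi : det_mono i)
    (hi' : det_mono i') (f f' : hom D Y) :
  i = i' -> f = f' -> span_class (Span i hi f) = span_class (Span i' hi' f').
Proof.
move=> ei ef; apply/span_classP/span_equivW.
by split; exists (idm D); rewrite /= ei ef !compm1.
Qed.

(* r represents s followed by t, for some choice of the pullback. *)
Definition is_composite X Y Z (s : span X Y) (t : span Y Z) (r : span X Z) :=
  exists (u : hom (sdom r) (sdom s)) (v : hom (sdom r) (sdom t)),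
    [/\ is_pullback (smap s) (sleg t) u v,
        sleg r = sleg s ∘ u & smap r = smap t ∘ v].

Lemma is_composite_le X Y Z (s s' : span X Y) (t t' : span Y Z)
    (r r' : span X Z) : span_le s s' -> span_le t t' ->
  is_composite s t r -> is_composite s' t' r' -> span_le r r'.
Proof.
move=> [a [a1 a2]] [b [b1 b2]] [u [v [[e _] r1 r2]]] [u' [v' [pb' r1' r2']]].
have /(pb_factor pb')[w [w1 w2]] : smap s' ∘ (a ∘ u) = sleg t' ∘ (b ∘ v).
  by rewrite !compA a2 b1.
exists w; rewrite r1' r2' -!compA w1 w2 r1 r2 -a1 -b2.
by rewrite !compA.
Qed.

End Spans.

Section Partial.
Variables (C : markov_category) (hC : partializable C).
Implicit Types X Y Z : C.

Lemma span_comp_ex X Y Z (s : span X Y) (t : span Y Z) :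
  exists r, is_composite s t r.
Proof.
have [D [u [v pb]]] :=
  partializable_pb_ex hC (smap s) (sleg_det_mono t).
have du := partializable_pb_det hC (sleg_det_mono t) pb.
by exists (Span _ (det_monoM (sleg_det_mono s) du) (smap t ∘ v)), u, v.
Qed.

Definition span_comp X Y Z (s : span X Y) (t : span Y Z) : span X Z :=
  projT1 (cid (span_comp_ex s t)).

Definition span_tens X Y X' Y' (s : span X Y) (s' : span X' Y') :
    span (X ⊗ X') (Y ⊗ Y') :=
  Span _ (det_mono_tens hC (sleg_det_mono s) (sleg_det_mono s'))
       (smap s ⊠ smap s').

Definition pincl X Y (f : hom X Y) : phom X Y :=
  span_class (Span (idm X) (det_mono1 X) f).

Definition pcomp X Y Z (q : phom Y Z) (p : phom X Y) : phom X Z :=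
  span_class (span_comp (repr p) (repr q)).

Definition ptens X Y X' Y' (p : phom X Y) (p' : phom X' Y') :
    phom (X ⊗ X') (Y ⊗ Y') :=
  span_class (span_tens (repr p) (repr p')).

Lemma repr_equiv X Y (s : span X Y) : span_equiv (repr (span_class s)) s.
Proof. by apply/span_classP; rewrite -span_classE. Qed.

Lemma pcompE X Y Z (s : span X Y) (t : span Y Z) r :
  is_composite s t r -> pcomp (span_class t) (span_class s) = span_class r.
Proof.
move=> sr; apply/span_classP/span_equivW.
have /span_equivW[s1 s2] := repr_equiv s.
have /span_equivW[t1 t2] := repr_equiv t.
rewrite /span_comp; case: cid => r' /= sr'.
by split; [apply: is_composite_le sr' sr | apply: is_composite_le sr sr'].
Qed.

Lemma ptensE X Y X' Y' (s : span X Y) (s' : span X' Y') :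
  ptens (span_class s) (span_class s') = span_class (span_tens s s').
Proof.
have /span_equivW[[a [a1 a2]] [b [b1 b2]]] := repr_equiv s.
have /span_equivW[[a' [a1' a2']] [b' [b1' b2']]] := repr_equiv s'.
apply/span_classP/span_equivW; split.
  by exists (a ⊠ a'); rewrite /= -!tensmM a1 a2 a1' a2'.
by exists (b ⊠ b'); rewrite /= -!tensmM b1 b2 b1' b2'.
Qed.

Lemma pcomp_incl_l X Y Z (s : span X Y) (g : hom Y Z) :
  pcomp (pincl g) (span_class s) =
  span_class (Span _ (sleg_det_mono s) (g ∘ smap s)).
Proof.
apply: pcompE; exists (idm _), (smap s); split=> /=; rewrite ?compm1 //.
apply: pb_intro; try exact: mono1; first by rewrite comp1m compm1.
by move=> T h k _; exists h; rewrite comp1m.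
Qed.

Lemma pcomp_incl_r X X' Y (s : span X Y) (s' : span X' Y) (f : hom X X')
    (t : hom (sdom s) (sdom s')) : is_iso f -> is_iso t ->
    f ∘ sleg s = sleg s' ∘ t -> smap s = smap s' ∘ t ->
  pcomp (span_class s') (pincl f) = span_class s.
Proof.
move=> fi ti e1 e2; apply: pcompE; exists (sleg s), t.
split; rewrite /= ?comp1m //.
apply: pb_iso => //; first exact: (sleg_det_mono s').2.
exact: (sleg_det_mono s).2.
Qed.

Lemma pcomp1m X Y (p : phom X Y) : pcomp (pincl (idm Y)) p = p.
Proof.
rewrite {1}(span_classE p) pcomp_incl_l [RHS]span_classE.
by case: (repr p) => * /=; apply: span_class_ext; rewrite ?comp1m.
Qed.

Lemma pcompm1 X Y (p : phom X Y) : pcomp p (pincl (idm X)) = p.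
Proof.
rewrite (span_classE p).
by apply: (pcomp_incl_r (t := idm _)); rewrite ?comp1m ?compm1 //; exact: iso1.
Qed.

Lemma pcompA W X Y Z (p : phom Y Z) (q : phom X Y) (r : phom W X) :
  pcomp p (pcomp q r) = pcomp (pcomp p q) r.
Proof.
rewrite (span_classE p) (span_classE q) (span_classE r).
move: (repr p) (repr q) (repr r) => {p q r}h g f.
have [gf cgf] := span_comp_ex f g; have [hg chg] := span_comp_ex g h.
rewrite (pcompE cgf) (pcompE chg).
case: cgf chg => [u1 [v1 [pb1 l1 m1]]] [u2 [v2 [pb2 l2 m2]]].
have du2 := partializable_pb_det hC (sleg_det_mono h) pb2.
have [E [u3 [v3 pb3]]] := partializable_pb_ex hC v1 du2.
have du3 := partializable_pb_det hC du2 pb3.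
pose r := Span _ (det_monoM (sleg_det_mono gf) du3) (smap hg ∘ v3).
rewrite (pcompE (r := r)); last first.
  exists u3, (v2 ∘ v3); split=> //=; last by rewrite m2 compA.
  by rewrite m1; apply: pb_paste pb2 pb3; exact: (sleg_det_mono h).2.
rewrite (pcompE (r := r)) //; exists (u1 ∘ u3), v3; split=> //=.
  rewrite l2; apply: pb_paste_mono pb1 pb3; last exact: du2.2.
  exact: (sleg_det_mono g).2.
by rewrite l1 compA.
Qed.

Definition partial_category : category :=
  @Category C (@phom C) (fun X => pincl (idm X)) (@pcomp)
    pcomp1m pcompm1 pcompA.

Definition pinc X Y (f : hom X Y) : @hom partial_category X Y := pincl f.
Definition pten X Y X' Y' (p : @hom partial_category X Y)
    (p' : @hom partial_category X' Y') :
    @hom partial_category (X ⊗ X') (Y ⊗ Y') := ptens p p'.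

Lemma pincM X Y Z (g : hom Y Z) (f : hom X Y) : pinc g ∘ pinc f = pinc (g ∘ f).
Proof. exact: pcomp_incl_l. Qed.

Lemma pincT X Y X' Y' (f : hom X Y) (f' : hom X' Y') :
  pten (pinc f) (pinc f') = pinc (f ⊠ f').
Proof. by rewrite /pten ptensE; apply: span_class_ext; rewrite ?tensm1. Qed.

Lemma pinc1 X : idm (X : partial_category) = pinc (idm X).
Proof. by []. Qed.

Lemma pincK X Y (f : hom X Y) (g : hom Y X) :
  g ∘ f = idm X -> pinc g ∘ pinc f = idm _.
Proof. by rewrite pincM => ->. Qed.

Lemma ptensmM (X Y Z X' Y' Z' : partial_category) (g : hom Y Z) (f : hom X Y)
    (g' : hom Y' Z') (f' : hom X' Y') :
  pten (g ∘ f) (g' ∘ f') = pten g g' ∘ pten f f'.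
Proof.
rewrite (span_classE f) (span_classE g) (span_classE f') (span_classE g').
move: (repr f) (repr g) (repr f') (repr g') => {}f {}g {}f' {}g'.
have [r c] := span_comp_ex f g; have [r' c'] := span_comp_ex f' g'.
rewrite /pten /comp /= (pcompE c) (pcompE c') !ptensE; apply/esym/pcompE.
case: c c' => [u [v [pb l m]]] [u' [v' [pb' l' m']]].
exists (u ⊠ u'), (v ⊠ v'); rewrite /= l m l' m' !tensmM; split=> //.
by apply: pb_tens => //; exact: sleg_det_mono.
Qed.

Lemma pinc_nat X X' Y Y' (s : span X Y) (s' : span X' Y') (f : hom X X')
    (g : hom Y Y') (t : hom (sdom s) (sdom s')) : is_iso f -> is_iso t ->
    f ∘ sleg s = sleg s' ∘ t -> g ∘ smap s = smap s' ∘ t ->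
  pinc g ∘ (span_class s : @hom partial_category _ _) =
  (span_class s' : @hom partial_category _ _) ∘ pinc f.
Proof.
move=> fi ti e1 e2; rewrite /pinc /comp /= pcomp_incl_l.
by apply/esym/pcomp_incl_r; [exact: fi | exact: ti | exact: e1 | exact: e2].
Qed.

Lemma passoc_nat (X X' Y Y' Z Z' : partial_category)
    (f : hom X X') (g : hom Y Y') (h : hom Z Z') :
  pinc (assoc X' Y' Z') ∘ pten (pten f g) h =
  pten f (pten g h) ∘ pinc (assoc X Y Z).
Proof.
rewrite (span_classE f) (span_classE g) (span_classE h) /pten !ptensE.
move: (repr f) (repr g) (repr h) => {}f {}g {}h.
apply: (@pinc_nat _ _ _ _ (span_tens (span_tens f g) h)
  (span_tens f (span_tens g h)) _ _ (assoc _ _ _)); rewrite /= ?assoc_nat //.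
  by eexists; split; [exact: assocK | exact: assocVK].
by eexists; split; [exact: assocK | exact: assocVK].
Qed.

Lemma plunit_nat (X X' : partial_category) (f : hom X X') :
  pinc (lunit X') ∘ pten (@idm partial_category (unit_ob : C)) f = f ∘ pinc (lunit X).
Proof.
rewrite (span_classE f) /pten ptensE; move: (repr f) => {}f.
apply: (@pinc_nat _ _ _ _ (span_tens (Span _ (det_mono1 _) (idm _)) f)
  f _ _ (lunit _)); rewrite /= ?lunit_nat //.
  by eexists; split; [exact: lunitK | exact: lunitVK].
by eexists; split; [exact: lunitK | exact: lunitVK].
Qed.

Lemma prunit_nat (X X' : partial_category) (f : hom X X') :
  pinc (runit X') ∘ pten f (@idm partial_category (unit_ob : C)) = f ∘ pinc (runit X).
Proof.
rewrite (span_classE f) /pten ptensE; move: (repr f) => {}f.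
apply: (@pinc_nat _ _ _ _ (span_tens f (Span _ (det_mono1 _) (idm _)))
  f _ _ (runit _)); rewrite /= ?runit_nat //.
  by eexists; split; [exact: runitK | exact: runitVK].
by eexists; split; [exact: runitK | exact: runitVK].
Qed.

Lemma pbraid_nat (X X' Y Y' : partial_category) (f : hom X X') (g : hom Y Y') :
  pinc (braid X' Y') ∘ pten f g = pten g f ∘ pinc (braid X Y).
Proof.
rewrite (span_classE f) (span_classE g) /pten !ptensE.
move: (repr f) (repr g) => {}f {}g.
apply: (@pinc_nat _ _ _ _ (span_tens f g) (span_tens g f) _ _ (braid _ _)); rewrite /= ?braid_nat //.
  by eexists; split; exact: braidK.
by eexists; split; exact: braidK.
Qed.

Definition partial_smcategory : smcategory.
Proof.
refine (@SMCategory partial_category (fun X Y : C => X ⊗ Y) (@pten) unit_ob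
  (fun X Y Z => pinc (assoc X Y Z)) (fun X Y Z => pinc (assocV X Y Z))
  (fun X => pinc (lunit X)) (fun X => pinc (lunitV X))
  (fun X => pinc (runit X)) (fun X => pinc (runitV X))
  (fun X Y => pinc (braid X Y))
  _ ptensmM _ _ _ _ _ _ _ passoc_nat plunit_nat prunit_nat pbraid_nat
  _ _ _ _ _).
- by move=> X Y; rewrite !pinc1 pincT tensm1.
- by move=> X Y Z; apply: pincK; exact: assocK.
- by move=> X Y Z; apply: pincK; exact: assocVK.
- by move=> X; apply: pincK; exact: lunitK.
- by move=> X; apply: pincK; exact: lunitVK.
- by move=> X; apply: pincK; exact: runitK.
- by move=> X; apply: pincK; exact: runitVK.
- by move=> X Y; apply: pincK; exact: braidK.
- by move=> X Y; rewrite !pinc1 !pincT pincM smc_triangle.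
- by move=> W X Y Z; rewrite !pinc1 !pincT !pincM smc_pentagon.
- by move=> X Y Z; rewrite !pinc1 !pincT !pincM smc_hexagon.
- by rewrite smc_unit.
- by move=> X; rewrite pincM smc_braid_unit.
Defined.

Lemma swap_mid_pinc (W X Y Z : C) :
  @swap_mid partial_smcategory W X Y Z = pinc (swap_mid W X Y Z).
Proof. by rewrite /swap_mid -!pincM -!pincT -!pincM -pincT. Qed.

Definition Partial : cd_category.
Proof.
refine (@CDCategory partial_smcategory
  (fun X : C => pinc (copy X)) (fun X : C => pinc (del X)) _ _ _ _ _ _ _).
- by move=> X; have := congr1 (@pinc _ _) (copyA X); rewrite -!pincM -!pincT.
- by move=> X; have := congr1 (@pinc _ _) (copy_dell X); rewrite -!pincM -!pincT.
- by move=> X; have := congr1 (@pinc _ _) (copyC X); rewrite -!pincM.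
- move=> X Y; rewrite swap_mid_pinc.
  by have := congr1 (@pinc _ _) (copy_tens X Y); rewrite -pincM -pincT.
- by move=> X Y; have := congr1 (@pinc _ _) (del_tens X Y); rewrite -pincM -pincT.
- by have := congr1 (@pinc _ _) (copy_unit C).
- by have := congr1 (@pinc _ _) (del_unit C).
Defined.

Definition span_mor X Y D (i : hom D X) (hi : det_mono i) (f : hom D Y) :
  @hom Partial X Y := span_class (Span i hi f).

End Partial.

Arguments span_mor {C} hC {X Y D} i hi f.

(* Main.v *)
From mathcomp Require Import ssreflect ssrfun.
Require Import Defs.
Local Open Scope cd_scope.

(** Write [(A, i, f)] for [span_mor hC i hi f].  Two observations reduce every
    claim to an equation between morphisms of the Markov category.

    First, for a fixed leg [i] the class [(A, i, f)] determines [f]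
    ([span_mor_inj]): an isomorphism of spans commutes with the monomorphism
    [i] on both sides, hence is the identity.

    Second, a composite needs no pullback to be computed when the first map
    already lands in the domain of the second span: if it is [j ∘ k], then its
    pullback along [j] is [(id, k)], so that
    [(B, j, g) ∘ (A, i, j ∘ k) = (A, i, g ∘ k)] ([span_mor_comp_factor]).

    An idempotent [(A, i, f)] is of this kind: the isomorphism between [A] and
    the domain of [(A, i, f) ∘ (A, i, f)] is a section of the pullback
    projection to [A], which makes [f] factor as [i ∘ e]
    ([idempotent_span_factor]), and then [(A, i, i ∘ e)] is idempotent exactly
    when [e] is.  A splitting [e = s ∘ r] gives the splitting of [(A, i, i ∘ e)]
    into [(A, i, r)] and the total morphism [i ∘ s].  Finally, as [i] is
    copyable, each side of the equations that define static, strong and balanced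
    idempotents is [(A, i, (i ⊠ i) ∘ c)], where [c] is the same side for [e];
    both [(A, i, -)] and composition with the monomorphism [i ⊠ i] are injective.
    Only [(p ⊠ p) ∘ copy], in the definition of strong, has no factorization
    to start with; there the point is that the square [copy X ∘ i =
    (i ⊠ i) ∘ copy A] is a pullback ([copy_pullback]). *)

Section PartialIdempotents.
Variables (C : markov_category) (hC : partializable C).
Implicit Types X Y Z A B D E : C.

Lemma span_mor_surj {X Y} (p : @hom (Partial hC) X Y) :
  exists (A : C) (i : hom A X) (hi : det_mono i) (f : hom A Y),
    p = span_mor hC i hi f.
Proof.
have := span_classE (p : phom X Y).
by case: (generic_quotient.repr _) => A i hi f ->; exists A, i, hi, f.
Qed.

Lemma span_mor_inj {X Y A} (i : hom A X) (hi : det_mono i) (f g : hom A Y) :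
  span_mor hC i hi f = span_mor hC i hi g <-> f = g.
Proof.
split=> [/span_classP[t [_ /= it ft]]|->] //.
have t1 : t = idm A by apply: (proj2 hi); rewrite it compm1.
by rewrite -ft t1 compm1.
Qed.

Lemma span_mor_comp {X Y Z A B D} (i : hom A X) (hi : det_mono i)
    (f : hom A Y) (j : hom B Y) (hj : det_mono j) (g : hom B Z)
    (u : hom D A) (v : hom D B) (hu : det_mono (i ∘ u)) :
  is_pullback f j u v ->
  span_mor hC j hj g ∘ span_mor hC i hi f = span_mor hC (i ∘ u) hu (g ∘ v).
Proof. by move=> pb; apply: (pcompE hC); exists u, v. Qed.

Lemma span_mor_comp_factor {X Y Z A B} (i : hom A X) (hi : det_mono i)
    (j : hom B Y) (hj : det_mono j) (k : hom A B) (g : hom B Z) :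
  span_mor hC j hj g ∘ span_mor hC i hi (j ∘ k) = span_mor hC i hi (g ∘ k).
Proof.
have hi1 : det_mono (i ∘ idm A) by rewrite compm1.
rewrite (span_mor_comp _ _ _ _ _ _ (idm A) k hi1); last first.
  apply: pb_intro; [exact: (proj2 hj) | exact: mono1 | by rewrite compm1 |].
  by move=> T h l _; exists h; rewrite comp1m.
by apply: span_class_ext; rewrite ?compm1.
Qed.

Lemma span_mor_tens {X Y A X' Y' A'} (i : hom A X) (hi : det_mono i)
    (f : hom A Y) (i' : hom A' X') (hi' : det_mono i') (f' : hom A' Y') :
  @tensm (Partial hC) _ _ _ _ (span_mor hC i hi f) (span_mor hC i' hi' f') =
  span_mor hC (i ⊠ i') (det_mono_tens hC hi hi') (f ⊠ f').
Proof. exact: ptensE. Qed.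

Lemma idempotent_span_mor {X A} (i : hom A X) (hi : det_mono i) (e : hom A A) :
  idempotent (span_mor hC i hi (i ∘ e)) <-> idempotent e.
Proof.
rewrite /idempotent span_mor_comp_factor span_mor_inj -compA.
by split=> [/(proj2 hi)|->].
Qed.

(** Idempotence makes the pullback projection [u] of [f] along [i] split: the
    isomorphism [t] of spans satisfies [i ∘ u ∘ t = i], hence [u ∘ t = idm A],
    and [f = f ∘ u ∘ t = i ∘ (v ∘ t)]. *)
Lemma idempotent_span_factor {X A} (i : hom A X) (hi : det_mono i)
    (f : hom A X) :
  idempotent (span_mor hC i hi f) -> exists e : hom A A, f = i ∘ e.
Proof.
have [D [u [v pb]]] := partializable_pb_ex hC f hi.
have hu := det_monoM hi (partializable_pb_det hC hi pb).
rewrite /idempotent (span_mor_comp _ _ _ _ _ _ _ _ hu pb).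
move=> /esym/span_classP[t [_ /= it _]].
have ut : u ∘ t = idm A by apply: (proj2 hi); rewrite compA it compm1.
by exists (v ∘ t); rewrite compA -(proj1 pb) -compA ut compm1.
Qed.

Lemma splits_span_mor {X A} (i : hom A X) (hi : det_mono i) (e : hom A A) :
  splits e -> splits (span_mor hC i hi (i ∘ e)).
Proof.
move=> [E [r [s [-> rs]]]].
exists E, (span_mor hC i hi r), (span_mor hC (idm E) (det_mono1 E) (i ∘ s)).
split; last by rewrite span_mor_comp_factor rs.
by rewrite -{2}(comp1m r) span_mor_comp_factor compA.
Qed.

(** A point whose two copies lie in [A] lies in [A]: the projection of
    [copy X ∘ h = (i ⊠ i) ∘ k] to the first factor factors [h] through [i]. *)
Lemma copy_pullback {X A} (i : hom A X) (hi : det_mono i) :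
  is_pullback (copy X) (i ⊠ i) i (copy A).
Proof.
apply: pb_intro.
- exact: (proj2 (det_mono_tens hC hi hi)).
- exact: (proj2 hi).
- exact: (proj2 (proj1 hi)).
move=> T h k /(congr1 (comp (projl X X))).
rewrite !compA projl_nat copy_delr comp1m => ->.
by exists (projl A A ∘ k); rewrite compA.
Qed.

(** The composites with [copy] from which the conditions on idempotents
    are assembled. *)
Section CopyComposites.
Variables (X A : C) (i : hom A X) (hi : det_mono i) (e : hom A A).
Let p : @hom (Partial hC) X X := span_mor hC i hi (i ∘ e).

Lemma copy_span_mor :
  @copy (Partial hC) X ∘ p = span_mor hC i hi ((i ⊠ i) ∘ (copy A ∘ e)).
Proof.
have -> : @copy (Partial hC) X ∘ p = span_mor hC i hi (copy X ∘ (i ∘ e)).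
  exact: pcomp_incl_l.
by rewrite !compA (proj2 (proj1 hi)).
Qed.

Lemma tens_id_copy_span_mor :
  @tensm (Partial hC) _ _ _ _ p (@idm (Partial hC) X)
    ∘ @copy (Partial hC) X ∘ p =
  span_mor hC i hi ((i ⊠ i) ∘ ((e ⊠ idm A) ∘ copy A ∘ e)).
Proof.
rewrite -compA copy_span_mor.
have -> : (i ⊠ i) ∘ (copy A ∘ e) =
    (i ⊠ idm X) ∘ ((idm A ⊠ i) ∘ (copy A ∘ e)) by rewrite (tensml i i) -!compA.
have -> : @tensm (Partial hC) _ _ _ _ p (@idm (Partial hC) X) =
    span_mor hC (i ⊠ idm X) (det_mono_tens hC hi (det_mono1 X))
      ((i ∘ e) ⊠ idm X) by exact: span_mor_tens.
rewrite span_mor_comp_factor !compA -!tensmM !compm1.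
by rewrite comp1m.
Qed.

Lemma tens_copy_span_mor :
  @tensm (Partial hC) _ _ _ _ p p ∘ @copy (Partial hC) X =
  span_mor hC i hi ((i ⊠ i) ∘ ((e ⊠ e) ∘ copy A)).
Proof.
have hi1 : det_mono (idm X ∘ i) by rewrite comp1m.
rewrite span_mor_tens.
have /= -> := span_mor_comp (idm X) (det_mono1 X) (copy X) (i ⊠ i)
  (det_mono_tens hC hi hi) _ i (copy A) hi1 (copy_pullback i hi).
by apply: span_class_ext; rewrite ?comp1m // tensmM -compA.
Qed.

Lemma tens_copy_comp_span_mor :
  @tensm (Partial hC) _ _ _ _ p p ∘ @copy (Partial hC) X ∘ p =
  span_mor hC i hi ((i ⊠ i) ∘ ((e ⊠ e) ∘ copy A ∘ e)).
Proof. by rewrite tens_copy_span_mor span_mor_comp_factor !compA. Qed.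

Lemma span_mor_tens_inj (c d : hom A (A ⊗ A)) :
  span_mor hC i hi ((i ⊠ i) ∘ c) = span_mor hC i hi ((i ⊠ i) ∘ d) <-> c = d.
Proof.
rewrite span_mor_inj; split=> [|-> //].
exact: (proj2 (det_mono_tens hC hi hi)).
Qed.

Lemma static_span_mor : static p <-> static e.
Proof.
rewrite /static idempotent_span_mor tens_id_copy_span_mor copy_span_mor.
by rewrite span_mor_tens_inj.
Qed.

Lemma strong_span_mor : strong p <-> strong e.
Proof.
rewrite /strong idempotent_span_mor tens_id_copy_span_mor tens_copy_span_mor.
by rewrite span_mor_tens_inj.
Qed.

Lemma balanced_span_mor : balanced p <-> balanced e.
Proof.
rewrite /balanced idempotent_span_mor tens_id_copy_span_mor.
by rewrite tens_copy_comp_span_mor span_mor_tens_inj.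
Qed.

End CopyComposites.
End PartialIdempotents.

Theorem proposition1p13 (C : markov_category) (hC : partializable C) :
  (forall (X A : C) (i : hom A X) (hi : det_mono i) (f : hom A X),
     idempotent (span_mor hC i hi f) <->
     exists e : hom A A,
       idempotent e /\ span_mor hC i hi f = span_mor hC i hi (i ∘ e))
  /\
  ((forall (X : C) (e : hom X X), idempotent e -> splits e) ->
   forall (X : Partial hC) (p : hom X X), idempotent p -> splits p)
  /\
  (forall (X A : C) (i : hom A X) (hi : det_mono i) (e : hom A A),
     idempotent e ->
     (static (span_mor hC i hi (i ∘ e)) <-> static e) /\
     (strong (span_mor hC i hi (i ∘ e)) <-> strong e) /\
     (balanced (span_mor hC i hi (i ∘ e)) <-> balanced e)).
Proof.
split; [|split].
- move=> X A i hi f; split=> [pp|[e [ee ->]]]; last exact/idempotent_span_mor.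
  have [e fe] := idempotent_span_factor C hC i hi f pp; exists e.
  by move: pp; rewrite fe => /idempotent_span_mor.
- move=> idem_splits X p; have [A [i [hi [f ->]]]] := span_mor_surj C hC p => pp.
  have [e fe] := idempotent_span_factor C hC i hi f pp.
  move: pp; rewrite fe => /idempotent_span_mor ee.
  exact/splits_span_mor/idem_splits.
- move=> X A i hi e _; split; first exact: static_span_mor.
  by split; [exact: strong_span_mor | exact: balanced_span_mor].
Qed.
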